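(* Let $\alpha_1,\alpha_2,\alpha_3,\alpha_4$ be odd integers greater than $1$ and set $$n_1=(\alpha_2-1)(\alpha_3-1)\alpha_4+\alpha_2,\quad n_2=(\alpha_3-1)(\alpha_4-1)\alpha_1+\alpha_3,$$ $$n_3=(\alpha_4-1)(\alpha_1-1)\alpha_2+\alpha_4,\quad n_4=(\alpha_1-1)(\alpha_2-1)\alpha_3+\alpha_1.$$ If $\gcd(n_1,n_2,n_3,n_4)=1$, then $S=\langle n_1,n_2,n_3,n_4\rangle$ is a numerical semigroup of embedding dimension four, generated by odd integers, which is almost symmetric of type three. Moreover, every almost symmetric numerical semigroup of embedding dimension four and type three whose minimal generators are all odd arises in this way (for suitable odd $\alpha_i>1$).
   Context: $\mathrm{PF}(S)$ is the set of integers $f\notin S$ with $f+s\in S$ for all $s\in S\setminus\{0\}$; the type of $S$ is $|\mathrm{PF}(S)|$; $S$ is almost symmetric if $2|\mathbb{N}\setminus S|=F(S)+|\mathrm{PF}(S)|$, where $F(S)=\max(\mathbb{Z}\setminus S)$. The embedding dimension is the number of minimal generators. *)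

(* Defs.v *)
From mathcomp Require Import all_boot.
Set Implicit Arguments. Unset Strict Implicit. Unset Printing Implicit Defensive.

Fixpoint in_gen (gens : seq nat) (x : nat) : bool :=
  match gens with
  | [::] => x == 0
  | g :: gs => [exists k : 'I_x.+1, (k * g <= x) && in_gen gs (x - k * g)]
  end.

Definition numerical_semigroup (S : pred nat) : Prop :=
  S 0 /\ (forall x y, S x -> S y -> S (x + y)) /\
  exists N, forall x, N <= x -> S x.

Definition min_gen (S : pred nat) (x : nat) : Prop :=
  0 < x /\ S x /\ ~ (exists a b, 0 < a /\ 0 < b /\ S a /\ S b /\ a + b = x).

Definition card_is (P : nat -> Prop) (c : nat) : Prop :=
  exists l : seq nat, uniq l /\ (forall x, x \in l <-> P x) /\ size l = c.

Definition embdim (S : pred nat) (e : nat) : Prop := card_is (min_gen S) e.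

(* Frobenius number F(S) (for S <> N, where it is a nonnegative integer). *)
Definition frobenius (S : pred nat) (f : nat) : Prop :=
  ~~ S f /\ forall x, f < x -> S x.

(* Pseudo-Frobenius numbers (for S <> N they are all nonnegative). *)
Definition pseudo_frob (S : pred nat) (f : nat) : Prop :=
  ~~ S f /\ forall s, S s -> 0 < s -> S (f + s).

Definition genus (S : pred nat) (g : nat) : Prop := card_is (fun x => ~~ S x) g.

Definition sg_type (S : pred nat) (t : nat) : Prop := card_is (pseudo_frob S) t.

Definition almost_symmetric (S : pred nat) : Prop :=
  exists g f t, genus S g /\ frobenius S f /\ sg_type S t /\ 2 * g = f + t.

Definition gens4 (a1 a2 a3 a4 : nat) : seq nat :=
  [:: (a2 - 1) * (a3 - 1) * a4 + a2;
      (a3 - 1) * (a4 - 1) * a1 + a3;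
      (a4 - 1) * (a1 - 1) * a2 + a4;
      (a1 - 1) * (a2 - 1) * a3 + a1].

Definition gcd_seq (s : seq nat) : nat := foldr gcdn 0 s.

(* Main.v *)
Require Import Defs.
From mathcomp Require Import all_boot.
From mathcomp Require Import zify.
Set Implicit Arguments. Unset Strict Implicit. Unset Printing Implicit Defensive.

(* Put [b_i = a_i - 1] and [f = b_1 b_2 b_3 b_4 - 1]. The generators satisfy the cyclic relations
   [f + n_i = b_(i+1) n_(i+1)], so [b_(i+1)] copies of [n_(i+1)] may be traded for [n_i] and a
   carry [f]: every combination of the generators becomes [c_1 n_1 + ... + c_4 n_4 + t f] with
   digits [c_i < b_i]. There are [f + 1] digit vectors, they represent all residues modulo [f],
   and only the zero vector and the maximal one, of value [4 f], represent the same residue.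
   Complementing the digits [c_i] to [b_i - 1 - c_i] therefore matches [x] with [3 f - x], which
   shows that the pseudo-Frobenius numbers are [f], [2 f], [3 f] and that [S] is almost
   symmetric.

   Conversely, let [f], [g], [F] be the pseudo-Frobenius numbers. By almost symmetry [x] or
   [F - x] lies in [S] unless [x] is [f] or [g]; hence [F = f + g] is odd and we take [f] odd. Draw
   an arrow from [i] to [j] if [f + n_i - n_j] lies in [S]; by duality the arrows for [g] are the
   reversed non-arrows. Factor each [f + n_i] and [g + n_i] over the generators. When several of
   these factorizations add up, modulo 2, to the generators [n_i] on the other sides, half of the
   resulting relation puts [f], [g] or [f + g] into [S]. As the generators are odd, the
   coefficients of [f + n_i] have an even sum and those of [g + n_i] an odd one, and a finite
   search over the possible parities shows that such a coincidence is unavoidable unless the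
   digraph is a directed four-cycle. In that case [f + n_i = b_(i+1) n_(i+1)] with [b_i] even,
   comparing the factorizations of consecutive [g + n_i] gives [g = 2 f], and since [f], [2 f],
   [3 f] are gaps the digit vectors are again distinct modulo [f]. So [f + 1 = b_1 b_2 b_3 b_4],
   and the cyclic relations determine the generators. *)

(** * Nonnegative combinations of a family of generators *)

Definition comb (I : finType) (n v : I -> nat) : nat := \sum_i v i * n i.

Definition delta (I : eqType) (i x : I) : nat := x == i.

Definition spanned_by (I : finType) (S : pred nat) (n : I -> nat) : Prop :=
  forall x, S x <-> exists v, x = comb n v.

Section Combinations.
Variables (I : finType) (n : I -> nat).
Implicit Types (u v : I -> nat) (i : I).

Lemma eq_comb u v : u =1 v -> comb n u = comb n v.
Proof. by move=> eq_uv; apply: eq_bigr => i _; rewrite eq_uv. Qed.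

Lemma comb0 : comb n (fun=> 0) = 0.
Proof. by apply: big1 => i _; rewrite mul0n. Qed.

Lemma combD u v : comb n (fun x => u x + v x) = comb n u + comb n v.
Proof. by rewrite /comb -big_split; apply: eq_bigr => i _; rewrite mulnDl. Qed.

Lemma combZ k u : comb n (fun x => k * u x) = k * comb n u.
Proof. by rewrite /comb [RHS]big_distrr /=; apply: eq_bigr => i _; rewrite mulnA. Qed.

Lemma comb_delta i : comb n (delta i) = n i.
Proof.
rewrite /comb (bigD1 i) //= /delta eqxx mul1n big1 ?addn0 // => j /negbTE->.
by rewrite mul0n.
Qed.

Lemma combB u v : (forall i, u i <= v i) -> comb n v = comb n u + comb n (fun i => v i - u i).
Proof. by move=> le_uv; rewrite -combD; apply: eq_comb => i; rewrite subnKC. Qed.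

Lemma comb_eq0 v : (forall i, 0 < n i) -> comb n v = 0 -> v =1 (fun=> 0).
Proof.
move=> n_gt0 /eqP; rewrite sum_nat_eq0 => /forallP v0 i; apply/eqP.
by have := v0 i; rewrite muln_eq0 [n i == 0]eqn0Ngt n_gt0 orbF.
Qed.

End Combinations.

Section Spanned.
Variables (I : finType) (n : I -> nat) (S : pred nat).
Hypothesis spanS : spanned_by S n.

Lemma spanned_comb v : S (comb n v).
Proof. by apply/spanS; exists v. Qed.

Lemma spanned0 : S 0.
Proof. by rewrite -(comb0 n) spanned_comb. Qed.

Lemma spannedD x y : S x -> S y -> S (x + y).
Proof. by move=> /spanS[u ->] /spanS[v ->]; rewrite -combD spanned_comb. Qed.

Lemma spanned_gen i : S (n i).
Proof. by rewrite -(comb_delta n) spanned_comb. Qed.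

Lemma spannedM k x : S x -> S (k * x).
Proof. by move=> /spanS[v ->]; rewrite -combZ spanned_comb. Qed.

Lemma spanned_split_gen x : S x -> 0 < x -> exists i s, S s /\ x = n i + s.
Proof.
case/spanS=> v ->; rewrite lt0n sum_nat_eq0 negb_forall => /existsP[i].
rewrite implyTb muln_eq0 negb_or => /andP[v_gt0 _].
exists i, (comb n (fun x => v x - delta i x)); split; first exact: spanned_comb.
rewrite -[n i](comb_delta n) -combB // => y; rewrite /delta.
by case: eqVneq => // ->; rewrite lt0n.
Qed.

Lemma spanned_by_bij (J : finType) (s : J -> I) : bijective s -> spanned_by S (n \o s).
Proof.
move=> [t st ts]; have comb_s v : comb (n \o s) v = comb n (v \o t).
  by rewrite /comb [RHS](reindex s) /=; [apply: eq_bigr => j _; rewrite /= st | exists t => ? _].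
move=> x; rewrite spanS; split=> -[v ->]; last by exists (v \o t).
by exists (v \o s); rewrite comb_s; apply: eq_comb => i; rewrite /= ts.
Qed.

Lemma eq_spanned_by (T : pred nat) (m : I -> nat) : spanned_by T m -> n =1 m -> S =1 T.
Proof.
move=> spanT eq_nm x; have eq_comb_nm v : comb n v = comb m v.
  by apply: eq_bigr => i _; rewrite eq_nm.
by apply/idP/idP=> [/spanS | /spanT] [v ->]; [apply/spanT | apply/spanS]; exists v.
Qed.

Section UniqueFactorization.
Hypothesis unique_factor : forall i v, comb n v = n i -> v =1 delta i.

Lemma unique_factor_gt0 i : 0 < n i.
Proof.
rewrite lt0n; apply/eqP => ni0.
by have := unique_factor (etrans (comb0 n) (esym ni0)) i; rewrite /delta eqxx.
Qed.

Lemma unique_factor_inj : injective n.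
Proof.
move=> i j Eij; have := unique_factor (etrans (comb_delta n i) Eij) i.
by rewrite /delta eqxx; case: eqP.
Qed.

Lemma unique_factor_min_gen x : min_gen S x <-> exists i, x = n i.
Proof.
split=> [[x_gt0 [Sx irr]] | [i ->]].
  have [i [s [Ss Ex]]] := spanned_split_gen Sx x_gt0; exists i.
  have [s0|s_gt0] := posnP s; first by rewrite Ex s0 addn0.
  by case: irr; exists (n i), s; rewrite unique_factor_gt0 spanned_gen.
split; [exact: unique_factor_gt0 | split; first exact: spanned_gen].
case=> a [b [a_gt0 [b_gt0 [/spanS[u Ea] [/spanS[v Eb] Eab]]]]].
have Euv : u i + v i = 1 /\ forall j, j != i -> u j + v j = 0.
  have /unique_factor sum_uv : comb n (fun j => u j + v j) = n i by rewrite combD -Ea -Eb.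
  by split=> [|j /negbTE ne_ji]; rewrite sum_uv /delta ?eqxx ?ne_ji.
have zero w : w i = 0 -> (forall j, j != i -> w j = 0) -> comb n w = 0.
  move=> wi wj; rewrite -(comb0 n); apply: eq_comb => j.
  by have [->|/wj] := eqVneq j i.
have [u0|v0] : u i = 0 \/ v i = 0 by lia.
  by rewrite Ea zero // in a_gt0 => j /(proj2 Euv); lia.
by rewrite Eb zero // in b_gt0 => j /(proj2 Euv); lia.
Qed.

Lemma unique_factor_embdim : embdim S #|I|.
Proof.
exists (codom n); split; first exact/injectiveP/unique_factor_inj.
split; last by rewrite size_codom.
by move=> x; rewrite unique_factor_min_gen; split=> [/codomP | ] [i ->]; [exists i | apply: codom_f].
Qed.

End UniqueFactorization.
End Spanned.

Lemma embdim_gens (S : pred nat) (e : nat) : numerical_semigroup S -> embdim S e ->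
  exists n : 'I_e -> nat, [/\ injective n, spanned_by S n & forall i, min_gen S (n i)].
Proof.
move=> [S0 [S_add _]] [gs [uniq_gs [gsP <-]]].
pose n (i : 'I_(size gs)) := nth 0 gs i.
have min_n i : min_gen S (n i) by apply/gsP/mem_nth.
exists n; split=> //.
  by move=> i j /eqP; rewrite nth_uniq // => /eqP/ord_inj.
move=> x; split=> [|[v ->]]; last first.
  apply: (big_ind S) => // i _; elim: (v i) => // k Sk.
  by rewrite mulSn S_add //; case: (min_n i) => _ [].
elim/ltn_ind: x => x IHx Sx; have [->|x_gt0] := posnP x; first by exists (fun=> 0); rewrite comb0.
have [/hasP[a] | /hasPn irr] := boolP (has (fun a => S a && S (x - a)) (iota 1 x.-1)).
  rewrite mem_iota => lt_ax /andP[Sa Sb].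
  have [|u Ea] := IHx a _ Sa; first by lia.
  have [|v Eb] := IHx (x - a) _ Sb; first by lia.
  by exists (fun i => u i + v i); rewrite combD -Ea -Eb; lia.
have /gsP/(nthP 0)[i lt_i <-] : min_gen S x.
  do 2!split=> //; case=> a [b [a_gt0 [b_gt0 [Sa [Sb Eab]]]]].
  have /irr : a \in iota 1 x.-1 by rewrite mem_iota; lia.
  by rewrite Sa (_ : x - a = b) ?Sb //; lia.
by exists (delta (Ordinal lt_i)); rewrite comb_delta.
Qed.

Lemma in_gen_cons (g : nat) (gs : seq nat) (x : nat) :
  in_gen (g :: gs) x <-> exists k y, in_gen gs y /\ x = k * g + y.
Proof.
split=> [/existsP[k /andP[le_kg gs_x]]|[k [y [gs_y ->]]]].
  by exists k, (x - k * g); rewrite subnKC.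
have [->|g_gt0] := posnP g.
  by apply/existsP; exists ord0; rewrite /= muln0 subn0.
have lt_k : k < (k * g + y).+1 by rewrite ltnS; nia.
by apply/existsP; exists (Ordinal lt_k); rewrite /= leq_addr addKn.
Qed.

Lemma in_gen_spanned (gs : seq nat) : spanned_by (in_gen gs) (fun i : 'I_(size gs) => nth 0 gs i).
Proof.
elim: gs => [|g gs IHgs] x.
  by split=> [/eqP->|[v ->]]; [exists (fun=> 0) |]; rewrite /comb big_ord0.
rewrite in_gen_cons; split=> [[k [y [/IHgs[v ->] ->]]] | [v ->]].
  exists (fun i => if unlift ord0 i is Some j then v j else k).
  rewrite /comb big_ord_recl unlift_none; congr (_ + _).
  by apply: eq_bigr => j _; rewrite liftK.
exists (v ord0), (comb (fun i : 'I_(size gs) => nth 0 gs i) (fun j => v (lift ord0 j))).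
by rewrite [comb _ v]big_ord_recl; split=> //; apply/IHgs; eexists.
Qed.

Lemma exists_muln_mod (g d x : nat) :
  0 < d -> gcdn g d %| x -> exists2 k, k < d & k * g = x %[mod d].
Proof.
move=> d_gt0; have [->|g_gt0] := posnP g => [|/dvdnP[c ->]].
  by rewrite gcd0n => /eqP x0; exists 0; rewrite // mul0n mod0n.
have [u v Ebezout _] := egcdnP d g_gt0.
exists ((c * u) %% d); rewrite ?ltn_mod // modnMml -mulnA Ebezout mulnDr mulnA.
by rewrite modnMDl.
Qed.

Lemma in_gen_gcd_cofinite (gs : seq nat) :
  exists N, forall x, N <= x -> gcd_seq gs %| x -> in_gen gs x.
Proof.
elim: gs => [|g gs [N gs_large]]; first by exists 0 => x _; rewrite dvd0n.
rewrite [gcd_seq _]/=; have [d0|d_gt0] := posnP (gcd_seq gs).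
  exists 0 => x _; rewrite -/(gcd_seq gs) d0 gcdn0 => /dvdnP[k ->].
  by apply/in_gen_cons; exists k, 0; rewrite addn0 (spanned0 (in_gen_spanned gs)).
exists (N + gcd_seq gs * g) => x le_x /(exists_muln_mod d_gt0)[k lt_k Ek].
have le_kg : k * g <= gcd_seq gs * g by rewrite leq_mul2r ltnW ?orbT.
apply/in_gen_cons; exists k, (x - k * g); rewrite subnKC; last by lia.
by split=> //; apply: gs_large; [lia | rewrite -eqn_mod_dvd ?Ek //; lia].
Qed.

(** * Almost symmetry and twin gaps *)

Lemma card_is_inj (P : nat -> Prop) (c d : nat) : card_is P c -> card_is P d -> c = d.
Proof.
move=> [s [us [sP <-]]] [t [ut [tP <-]]].
by apply/perm_size/uniq_perm => // x; apply/idP/idP => [/sP/tP|/tP/sP].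
Qed.

Lemma gap_leq_frobenius (S : pred nat) (F x : nat) : frobenius S F -> ~~ S x -> x <= F.
Proof. by case=> _ large; rewrite leqNgt; apply: contra => /large. Qed.

Lemma frobenius_inj (S : pred nat) (F G : nat) : frobenius S F -> frobenius S G -> F = G.
Proof.
move=> frobF frobG; apply/anti_leq.
by rewrite (gap_leq_frobenius frobG (proj1 frobF)) (gap_leq_frobenius frobF (proj1 frobG)).
Qed.

Lemma pseudo_frob_incomparable (S : pred nat) (f g s : nat) :
  pseudo_frob S f -> pseudo_frob S g -> S s -> f != g -> g <> f + s.
Proof.
move=> [_ pf_f] [gap_g _] Ss ne_fg g_fs; have [s0|s_gt0] := posnP s.
  by rewrite g_fs s0 addn0 eqxx in ne_fg.
by rewrite g_fs pf_f in gap_g.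
Qed.

Section TwinGaps.
Variables (S : pred nat) (F : nat).
Hypotheses (S_add : forall x y, S x -> S y -> S (x + y)) (frobF : frobenius S F).

Definition twin_gap (x : nat) : bool := ~~ S x && ~~ S (F - x).

Definition twin_gaps : seq nat := [seq x <- iota 0 F.+1 | twin_gap x].

Lemma twin_gap_sym x : twin_gap x -> twin_gap (F - x).
Proof. by case/andP=> gap_x gap_Fx; rewrite /twin_gap gap_Fx subKn // (gap_leq_frobenius frobF). Qed.

Lemma mem_twin_gaps x : (x \in twin_gaps) = twin_gap x.
Proof.
rewrite mem_filter mem_iota /= add0n ltnS andb_idr // => /andP[gap_x _].
exact: gap_leq_frobenius frobF gap_x.
Qed.

(* [x |-> F - x] maps the elements of [S] below [F] injectively into the gaps; what it misses are
   the twin gaps. *)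
Lemma double_count_gaps :
  2 * count (predC S) (iota 0 F.+1) = F.+1 + size twin_gaps.
Proof.
have count_refl : count (fun x => S (F - x)) (iota 0 F.+1) = count S (iota 0 F.+1).
  rewrite -(count_map (subn F)); apply/permP/uniq_perm; rewrite ?iota_uniq //.
    by rewrite map_inj_in_uniq ?iota_uniq // => x y; rewrite !mem_iota; lia.
  move=> x; rewrite mem_iota; apply/mapP/idP => [[y] | lt_x].
    by rewrite mem_iota; lia.
  by exists (F - x); rewrite ?mem_iota; lia.
have split_gaps : count (predC S) (iota 0 F.+1) =
    count (fun x => S (F - x)) (iota 0 F.+1) + size twin_gaps.
  rewrite size_filter -count_predUI [X in _ + X](_ : _ = 0) ?addn0; last first.
    apply: etrans (count_pred0 (iota 0 F.+1)); apply: eq_count => x.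
    by rewrite /= /twin_gap; case: (S (F - x)); rewrite ?andbF.
  apply: eq_in_count => x; rewrite mem_iota /= add0n ltnS /twin_gap => le_xF.
  have [SFx|] := boolP (S (F - x)); rewrite ?andbT //=; apply: contra (proj1 frobF) => Sx.
  by rewrite -(subnKC le_xF) S_add.
have := count_predC S (iota 0 F.+1); rewrite size_iota; lia.
Qed.

Lemma genus_count : genus S (count (predC S) (iota 0 F.+1)).
Proof.
exists (filter (predC S) (iota 0 F.+1)); rewrite filter_uniq ?iota_uniq ?size_filter //.
split=> //; split=> // x; rewrite mem_filter mem_iota /= add0n ltnS.
by split=> [/andP[]|gap_x] //; rewrite gap_x (gap_leq_frobenius frobF).
Qed.

Lemma pseudo_frob_frobenius : pseudo_frob S F.
Proof.
by split=> [|s _ s_gt0]; [case: frobF | apply: (proj2 frobF); rewrite -addn1 leq_add2l].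
Qed.

Lemma pseudo_frob_twin_gap x : pseudo_frob S x -> x != F -> twin_gap x.
Proof.
move=> [gap_x pf_x] ne_xF; have le_xF := gap_leq_frobenius frobF gap_x.
rewrite /twin_gap gap_x; apply: contra (proj1 frobF) => SFx.
by rewrite -(subnKC le_xF) pf_x // subn_gt0 ltn_neqAle ne_xF.
Qed.

Lemma almost_symmetric_typeE t : almost_symmetric S -> sg_type S t -> t = (size twin_gaps).+1.
Proof.
move=> [g [G [u [genus_g [frobG [type_u Eg]]]]]] type_t.
move: Eg; rewrite (card_is_inj type_u type_t) (card_is_inj genus_g genus_count) double_count_gaps.
by rewrite -(frobenius_inj frobF frobG) addSnnS => /addnI->.
Qed.

Hypothesis S0 : S 0.

Lemma almost_symmetricP :
  almost_symmetric S <-> (forall x, twin_gap x -> pseudo_frob S x).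
Proof.
split=> [asymS | twin_pf].
  have [_ [_ [t [_ [_ [type_t _]]]]]] := asymS; have size_twin := almost_symmetric_typeE asymS type_t.
  case: type_t => [pfs [uniq_pfs [pfsP size_pfs]]].
  have sub_twin : {subset rem F pfs <= twin_gaps}.
    move=> x; rewrite mem_rem_uniq // mem_twin_gaps.
    by case/andP=> [ne_xF /pfsP/pseudo_frob_twin_gap]; apply.
  have [|_ eq_twin] := uniq_min_size (rem_uniq F uniq_pfs) sub_twin.
    rewrite size_rem ?size_pfs ?size_twin //.
    exact/pfsP/pseudo_frob_frobenius.
  by move=> x; rewrite -mem_twin_gaps -eq_twin mem_rem_uniq // => /andP[_ /pfsP].
exists (count (predC S) (iota 0 F.+1)), F, (size twin_gaps).+1.
rewrite double_count_gaps addSnnS; split; [exact: genus_count | do 2!split=> //].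
have F_ntwin : F \notin twin_gaps by rewrite mem_twin_gaps /twin_gap subnn S0 andbF.
exists (F :: twin_gaps); rewrite /= F_ntwin filter_uniq ?iota_uniq //; do 2!split=> //.
move=> x; rewrite inE mem_twin_gaps; split=> [/predU1P[-> | /twin_pf //] | pf_x].
  exact: pseudo_frob_frobenius.
by have [|ne_xF] := eqVneq x F; last exact: pseudo_frob_twin_gap.
Qed.

End TwinGaps.

(* The two twin gaps are exchanged by [x |-> F - x], since both would be [F / 2] if one of them
   were fixed. *)
Lemma almost_symmetric_type3 (S : pred nat) :
  numerical_semigroup S -> almost_symmetric S -> sg_type S 3 ->
  exists f g, [/\ odd f, ~~ odd g, pseudo_frob S f & pseudo_frob S g] /\
    frobenius S (f + g) /\ forall x, twin_gap S (f + g) x -> x = f \/ x = g.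
Proof.
move=> [S0 [S_add _]] asymS type3; have [_ [F [_ [_ [frobF _]]]]] := asymS.
have twin_pf := (almost_symmetricP S_add frobF S0).1 asymS.
have [a [b [ne_ab twinE]]] : exists a b, a != b /\ forall x, twin_gap S F x <-> x = a \/ x = b.
  have uniq_twin : uniq (twin_gaps S F) by rewrite filter_uniq ?iota_uniq.
  have mem_twin := mem_twin_gaps frobF; have := almost_symmetric_typeE S_add frobF asymS type3.
  case: (twin_gaps S F) uniq_twin mem_twin => [|a [|b []]] // + mem_twin _.
  rewrite /= inE andbT => ne_ab; exists a, b; split=> // x; rewrite -mem_twin !inE.
  by split=> [/orP[]/eqP | [] ->]; rewrite ?eqxx ?orbT; auto.
have [twin_a twin_b] : twin_gap S F a /\ twin_gap S F b by split; apply/twinE; auto.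
have le_twin x : twin_gap S F x -> x <= F by case/andP=> /(gap_leq_frobenius frobF).
have sum_ab : a + b = F.
  have := le_twin _ twin_a; have := le_twin _ twin_b.
  by have /twinE := twin_gap_sym frobF twin_a; have /twinE := twin_gap_sym frobF twin_b; lia.
have odd_F : odd F.
  apply: contraT => even_F; have half_F : F./2 + F./2 = F by lia.
  have /twinE : twin_gap S F F./2; last by lia.
  have gap_half : ~~ S F./2 by apply: contra (proj1 frobF) => S_half; rewrite -half_F S_add.
  by rewrite /twin_gap gap_half (_ : F - F./2 = F./2) //; lia.
wlog odd_a : a b ne_ab {twin_a twin_b} twinE sum_ab / odd a => [wlog_odd|].
  have [odd_a|even_a] := boolP (odd a); first exact: (wlog_odd a b).
  apply: (wlog_odd b a); rewrite 1?eq_sym 1?addnC //; first by move=> x; rewrite twinE or_comm.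
  by move: odd_F; rewrite -sum_ab oddD (negbTE even_a).
exists a, b; rewrite sum_ab; split; last by split=> // x /twinE.
by split; [| lia | apply/twin_pf/twinE; left | apply/twin_pf/twinE; right].
Qed.

(** * Cyclic relations and digit expansions *)

Lemma eqn_mod_addr d x y : x <= y -> y = x %[mod d] -> exists m, y = x + m * d.
Proof.
move=> le_xy /eqP; rewrite eqn_mod_dvd // => /dvdnP[m Em].
by exists m; rewrite -Em subnKC.
Qed.

Section CyclicRelations.
Variables (e : nat) (n b : 'I_e -> nat) (f : nat) (S : pred nat).
Hypotheses (spanS : spanned_by S n) (S_cofinite : exists N, forall x, N <= x -> S x).
Hypotheses (e_gt1 : 1 < e) (f_gt0 : 0 < f) (b_gt1 : forall i, 1 < b i).
Hypothesis cyclic_rel : forall i, f + n i = b (ordS i) * n (ordS i).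

Local Notation digits := {dffun forall i, 'I_(b i)}.

Definition digit (c : digits) (i : 'I_e) : nat := c i.

Definition digits_value (c : digits) : nat := comb n (digit c).

Definition digits0 : digits := [ffun i => Ordinal (ltnW (b_gt1 i))].

Definition digits_complement (c : digits) : digits := [ffun i => rev_ord (c i)].

Definition digits_max : digits := digits_complement digits0.

Lemma digits_complementK : involutive digits_complement.
Proof. by move=> c; apply/ffunP => i; rewrite !ffunE rev_ordK. Qed.

Lemma digits0_neq_max : digits0 != digits_max.
Proof.
apply/eqP => /ffunP/(_ (Ordinal (ltnW e_gt1)))/(congr1 val).
by rewrite !ffunE /=; have := b_gt1 (Ordinal (ltnW e_gt1)); lia.
Qed.

Lemma cyclic_gen_gt0 i : 0 < n i.
Proof.
have := cyclic_rel (ord_pred i); rewrite ord_predK.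
by case: (n i) => [|//]; rewrite muln0; lia.
Qed.

Lemma digits_value0 : digits_value digits0 = 0.
Proof. by apply: big1 => i _; rewrite /digit ffunE. Qed.

Lemma digits_value_complement c : digits_value c + digits_value (digits_complement c) = e * f.
Proof.
have sum_b : \sum_i b i * n i = e * f + \sum_i n i.
  have -> : e * f = \sum_(i < e) f by rewrite sum_nat_const card_ord.
  rewrite (reindex_inj (@ordS_inj e)) -big_split.
  by apply: eq_bigr => i _; rewrite /= cyclic_rel.
apply: (@addIn (\sum_i n i)); rewrite -sum_b /digits_value -combD -big_split.
by apply: eq_bigr => i _; rewrite /digit ffunE /=; have := ltn_ord (c i); nia.
Qed.

Lemma digits_value_max : digits_value digits_max = e * f.
Proof. by rewrite -[RHS](digits_value_complement digits0) digits_value0. Qed.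

Lemma spanned_addf s : S s -> 0 < s -> S (f + s).
Proof.
move=> Ss /(spanned_split_gen spanS Ss)[i [t [St ->]]].
by rewrite addnA cyclic_rel (spannedD spanS) // (spannedM spanS) // (spanned_gen spanS).
Qed.

Lemma spanned_add_mulf k s : S s -> 0 < s -> S (k * f + s).
Proof.
move=> Ss s_gt0; elim: k => [//|k Sk]; rewrite mulSn -addnA spanned_addf //.
by rewrite addn_gt0 s_gt0 orbT.
Qed.

(* Replacing [b (i+1)] copies of [n (i+1)] by [n i] and a carry [f] lowers the number of
   summands. *)
Lemma digit_expansion v : exists c t,
  [/\ comb n v = digits_value c + t * f, t = 0 -> v =1 digit c & c = digits0 -> v =1 (fun=> 0)].
Proof.
have [m] := ubnP (\sum_i v i); elim: m v => // m IHm v lt_m.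
have [/existsP[i le_bv] | /existsPn lt_vb] := boolP [exists i, b i <= v i]; last first.
  have {}lt_vb i : v i < b i by rewrite ltnNge.
  exists [ffun i => Ordinal (lt_vb i)], 0; rewrite addn0.
  split=> [|_ i|/ffunP c_zero i]; last by have /(congr1 val) := c_zero i; rewrite !ffunE.
    by apply: eq_comb => i; rewrite /digit ffunE.
  by rewrite /digit ffunE.
pose w x := v x - b i * delta i x.
have Ev x : v x = b i * delta i x + w x.
  by rewrite subnKC // /delta; case: eqP => [->|]; rewrite ?muln1 ?muln0.
pose u x := w x + delta (ord_pred i) x.
have comb_vu : comb n v = comb n u + f.
  rewrite (eq_comb _ Ev) !combD combZ !comb_delta; have := cyclic_rel (ord_pred i).
  by rewrite ord_predK; lia.
have sum_delta j : \sum_x delta j x = 1.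
  by rewrite -[RHS](comb_delta (fun=> 1) j); apply: eq_bigr => x _; rewrite muln1.
have lt_u : \sum_x u x < m.
  move: lt_m; rewrite (eq_bigr _ (fun x _ => Ev x)) !big_split -big_distrr /= !sum_delta.
  by have := b_gt1 i; lia.
have [c [t [Eu _ c_zero]]] := IHm u lt_u; exists c, t.+1.
split=> //; first by rewrite comb_vu Eu; lia.
by move/c_zero/(_ (ord_pred i)); rewrite /u /delta eqxx addn1.
Qed.

Lemma digits_value_onto x : exists2 c, c != digits_max & digits_value c = x %[mod f].
Proof.
have [N S_large] := S_cofinite.
have /spanS[v Ev] : S (N * f + x) by apply: S_large; nia.
have [c [t [Ec _ _]]] := digit_expansion v.
have Ex : digits_value c = x %[mod f] by rewrite -(modnMDl t) -(modnMDl N x) Ev Ec addnC.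
have [c_max|] := eqVneq c digits_max; last by exists c.
exists digits0; rewrite ?digits0_neq_max // -Ex c_max digits_value_max digits_value0.
by rewrite modnMl mod0n.
Qed.

Lemma digits_value_mod_injP :
  reflect {in [pred c | c != digits_max] &, injective (fun c => digits_value c %% f)}
          (\prod_i b i == f.+1).
Proof.
pose residue c := Ordinal (ltn_pmod (digits_value c) f_gt0).
have residue_onto : [set residue c | c in [set~ digits_max]] = setT.
  apply/setP => r; rewrite inE; have [c c_max Ec] := digits_value_onto r.
  apply/imsetP; exists c; first by rewrite !inE.
  by apply: val_inj; rewrite /= Ec modn_small.
have card_digits : #|[set~ digits_max]| = (\prod_i b i).-1.
  rewrite cardsC1 card_dep_ffun foldrE big_map big_enum; congr _.-1.
  by apply: eq_bigr => i _; rewrite card_ord.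
have prod_gt0 : 0 < \prod_i b i by apply: prodn_gt0 => i; apply: ltnW.
have -> : (\prod_i b i == f.+1) =
    (#|[set residue c | c in [set~ digits_max]]| == #|[set~ digits_max]|).
  by rewrite residue_onto cardsT card_ord card_digits -{1}(prednK prod_gt0) eqSS eq_sym.
apply: (iffP imset_injP) => inj_value c d; rewrite !inE => c_max d_max.
  by move=> Ecd; apply: inj_value; rewrite ?inE //; apply: val_inj.
by move/(congr1 val) => /=; apply: inj_value; rewrite inE.
Qed.

Lemma digits_value_gt0 c : c != digits0 -> 0 < digits_value c.
Proof.
rewrite lt0n; apply: contra_neq => /(comb_eq0 cyclic_gen_gt0) digit0.
by apply/ffunP => i; apply: val_inj; rewrite [LHS]digit0 ffunE.
Qed.

Lemma spanned_digits_value c t : c != digits0 -> S (digits_value c + t * f).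
Proof.
move=> /digits_value_gt0 c_gt0; rewrite addnC spanned_add_mulf //.
exact: (spanned_comb spanS).
Qed.

Lemma spanned_digitsP x : S x -> exists c t, x = digits_value c + t * f /\ (c = digits0 -> x = 0).
Proof.
case/spanS=> v ->; have [c [t [Ev _ v0]]] := digit_expansion v.
by exists c, t; split=> // /v0/(eq_comb n)->; rewrite comb0.
Qed.

(* If [c] and [d] have congruent values, [d] the smaller one, then [d] plus the complement of [c]
   is a factorization of some [k * f] with [k <= e]. Since the multiples below [e * f] are gaps,
   [k] is [0], so that [c] is maximal, or [e], and then the sum is the maximal digit vector. *)
Lemma cyclic_gaps_prod :
  (forall k, 0 < k < e -> ~~ S (k * f)) -> \prod_i b i = f.+1.
Proof.
move=> gap_mulf; apply/eqP/digits_value_mod_injP => c d; rewrite !inE => c_max d_max /eqP.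
wlog le_dc : c d c_max d_max / digits_value d <= digits_value c => [wlog_le|].
  have [le_dc|/ltnW le_cd] := leqP (digits_value d) (digits_value c); first exact: wlog_le.
  by move/eqP/esym/eqP => Ecd; apply/esym/wlog_le.
move/eqP/(eqn_mod_addr le_dc) => [t Ec].
pose v i := digit d i + digit (digits_complement c) i.
have sum_v : comb n v + t * f = e * f.
  by rewrite combD -(digits_value_complement c) Ec /digits_value addnAC.
have [u [m [Ev v_u v0]]] := digit_expansion v.
have Eu : digits_value u = (e - (m + t)) * f.
  by rewrite mulnBl -sum_v Ev -addnA -mulnDl addnK.
have [/eqP|mt_gt0] := posnP (m + t).
  rewrite addn_eq0 => /andP[/eqP/v_u {}v_u /eqP t0].
  have le_digit i : digit d i <= digit c i.
    by have := v_u i; rewrite /v /digit ffunE /=; have := ltn_ord (u i); have := ltn_ord (c i); lia.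
  have := combB n le_digit; rewrite -!/(digits_value _) Ec t0 addn0 -{1}[digits_value d]addn0.
  move/addnI/esym/(comb_eq0 cyclic_gen_gt0) => digit_diff.
  apply/ffunP => i; apply/val_inj/anti_leq; rewrite [val (d i) <= _]le_digit andbT.
  by rewrite -subn_eq0 [_ - _]digit_diff.
case/negP: c_max; rewrite -(digits_complementK c) /digits_max; apply/eqP; congr digits_complement.
suff /v0 v_0 : u = digits0.
  apply/ffunP => i; apply/val_inj; have /eqP := v_0 i.
  by rewrite addn_eq0 => /andP[_ /eqP Eci]; rewrite [LHS]Eci ffunE.
apply: contraTeq isT => /digits_value_gt0; rewrite Eu muln_gt0 f_gt0 andbT => k_gt0.
have /gap_mulf/negP[] : 0 < e - (m + t) < e by lia.
by rewrite -Eu (spanned_comb spanS).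
Qed.

Section UniqueDigits.
Hypothesis prod_b : \prod_i b i = f.+1.

Lemma digits_value_inj c d :
  c != digits_max -> d != digits_max -> digits_value c = digits_value d %[mod f] -> c = d.
Proof.
by move=> c_max d_max; apply: (elimT digits_value_mod_injP (introT eqP prod_b)).
Qed.

Lemma digits_value_mod0 c : c != digits_max -> digits_value c = 0 %[mod f] -> c = digits0.
Proof.
by move=> c_max c_mod0; apply: digits_value_inj; rewrite ?digits0_neq_max // c_mod0 digits_value0.
Qed.

Lemma cyclic_mulf_gap k : 0 < k < e -> ~~ S (k * f).
Proof.
case/andP=> k_gt0 lt_ke; apply/negP => /spanned_digitsP[c [t [Ek c_zero]]].
have [c_max|/digits_value_mod0 c_mod0] := eqVneq c digits_max.
  by rewrite c_max digits_value_max in Ek; nia.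
suff /c_zero : c = digits0 by nia.
by apply: c_mod0; rewrite -(modnMDl t) addnC -Ek modnMl mod0n.
Qed.

Lemma cyclic_frobenius : frobenius S (e.-1 * f).
Proof.
split=> [|x lt_x]; first by apply: cyclic_mulf_gap; lia.
have [c c_max Ec] := digits_value_onto x; have sum_c := digits_value_complement c.
have [le_cx|lt_xc] := leqP (digits_value c) x; last first.
  by have [[|t] Et] := eqn_mod_addr (ltnW lt_xc) Ec; nia.
have [t Et] := eqn_mod_addr le_cx (esym Ec).
have [c_zero|] := eqVneq c digits0; last by rewrite Et; apply: spanned_digits_value.
have max_neq0 : digits_max != digits0 by rewrite eq_sym digits0_neq_max.
have le_et : e <= t by move: lt_x; rewrite Et c_zero digits_value0 add0n ltn_pmul2r //; lia.
have -> : x = digits_value digits_max + (t - e) * f.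
  by rewrite digits_value_max -mulnDl subnKC // Et c_zero digits_value0.
exact: spanned_digits_value.
Qed.

(* If [x] lies [t.+1] steps of [f] below the value of [c], then [e.-1 * f - x] lies [t] steps
   above the value of the complement of [c]. *)
Lemma cyclic_twin_gap x :
  twin_gap S (e.-1 * f) x -> exists2 k, 0 < k < e & x = k * f.
Proof.
case/andP=> gap_x gap_Fx; have le_x := gap_leq_frobenius cyclic_frobenius gap_x.
have [c c_max Ec] := digits_value_onto x.
have [c_zero|c_neq0] := eqVneq c digits0.
  have [t Et] : exists t, x = 0 + t * f.
    by apply: eqn_mod_addr => //; rewrite -Ec c_zero digits_value0.
  exists t; last by rewrite Et.
  suff : 0 < t by nia.
  by case: posnP gap_x => // t0; rewrite Et t0 (spanned0 spanS).
have [le_cx|lt_xc] := leqP (digits_value c) x.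
  by have [t Et] := eqn_mod_addr le_cx (esym Ec); rewrite Et spanned_digits_value in gap_x.
have [[|t] Et] := eqn_mod_addr (ltnW lt_xc) Ec; first by lia.
case/negP: gap_Fx; suff -> : e.-1 * f - x = digits_value (digits_complement c) + t * f.
  apply: spanned_digits_value; apply: contra c_max => /eqP compl0.
  by rewrite -(digits_complementK c) compl0.
by have := digits_value_complement c; nia.
Qed.

Lemma cyclic_pseudo_frob x : pseudo_frob S x <-> exists2 k, 0 < k < e & x = k * f.
Proof.
split=> [pf_x | [k k_e ->]]; last first.
  by split=> [|s]; [apply: cyclic_mulf_gap | apply: spanned_add_mulf].
have [->|ne_xF] := eqVneq x (e.-1 * f); first by exists e.-1; rewrite //; lia.
exact/cyclic_twin_gap/(pseudo_frob_twin_gap cyclic_frobenius).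
Qed.

Lemma cyclic_sg_type : sg_type S e.-1.
Proof.
exists [seq k * f | k <- iota 1 e.-1]; rewrite size_map size_iota.
split; first by rewrite map_inj_uniq ?iota_uniq // => k l /eqP; rewrite eqn_pmul2r // => /eqP.
split=> // x; rewrite cyclic_pseudo_frob; split=> [/mapP[k] | [k k_e ->]].
  by rewrite mem_iota => k_e ->; exists k; lia.
by apply: map_f; rewrite mem_iota; lia.
Qed.

Lemma cyclic_almost_symmetric : almost_symmetric S.
Proof.
apply/(almost_symmetricP (spannedD spanS) cyclic_frobenius (spanned0 spanS)) => x twin_x.
exact/cyclic_pseudo_frob/cyclic_twin_gap.
Qed.

Lemma cyclic_unique_factor i v : comb n v = n i -> v =1 delta i.
Proof.
have lt_delta j : delta i j < b j by apply: leq_ltn_trans (b_gt1 j); apply: leq_b1.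
pose c : digits := [ffun j => Ordinal (lt_delta j)].
have digit_c : digit c =1 delta i by move=> j; rewrite /digit ffunE.
have c_neq0 : c != digits0.
  by apply/eqP => /ffunP/(_ i)/(congr1 val); rewrite [LHS]digit_c ffunE /delta eqxx.
have c_max : c != digits_max.
  have [j ne_ji] : exists j, j != i.
    have [->|ne_0i] := eqVneq i (Ordinal (ltnW e_gt1)); first by exists (Ordinal e_gt1).
    by exists (Ordinal (ltnW e_gt1)); rewrite eq_sym.
  apply/eqP => /ffunP/(_ j)/(congr1 val); rewrite [LHS]digit_c !ffunE /delta (negbTE ne_ji) /=.
  by have := b_gt1 j; lia.
have [u [t [Ev v_u _]]] := digit_expansion v; rewrite Ev => Eni.
have Ec : digits_value c = digits_value u + t * f.
  by rewrite Eni /digits_value (eq_comb n digit_c) comb_delta.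
have Emod : digits_value c = digits_value u %[mod f] by rewrite Ec addnC modnMDl.
have [u_max|/(digits_value_inj c_max)/(_ Emod) Ecu] := eqVneq u digits_max.
  case/eqP: c_neq0; apply: digits_value_mod0; first by [].
  by rewrite Emod u_max digits_value_max modnMl mod0n.
have t0 : t = 0 by rewrite Ecu in Ec; nia.
by move=> j; rewrite v_u // -Ecu digit_c.
Qed.

Lemma cyclic_min_gen x : min_gen S x <-> exists i, x = n i.
Proof. exact: (unique_factor_min_gen spanS cyclic_unique_factor). Qed.

Lemma cyclic_embdim : embdim S e.
Proof. by have := unique_factor_embdim spanS cyclic_unique_factor; rewrite card_ord. Qed.

End UniqueDigits.
End CyclicRelations.

(** * Four generators *)

Local Notation ordS2 i := (ordS (ordS i)).
Local Notation ordS3 i := (ordS (ordS (ordS i))).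

Lemma ordS4K (i : 'I_4) : ordS (ordS3 i) = i.
Proof. by apply: val_inj; case: i => [[|[|[|[|]]]]]. Qed.

Lemma big_ordS4 (R : Type) (idx : R) (op : Monoid.com_law idx) (F : 'I_4 -> R) (i : 'I_4) :
  \big[op/idx]_j F j =
  op (F i) (op (F (ordS i)) (op (F (ordS2 i)) (F (ordS3 i)))).
Proof.
have orbit_i : perm_eq (index_enum 'I_4) [:: i; ordS i; ordS2 i; ordS3 i].
  apply: uniq_perm; first exact: index_enum_uniq.
    by case: i => [[|[|[|[|]]]]].
  by move=> j; rewrite mem_index_enum; case: i j => [[|[|[|[|]]]] lt_i] // [[|[|[|[|]]]] lt_j].
by rewrite (perm_big _ orbit_i) !big_cons big_nil Monoid.mulm1.
Qed.

Definition cyclic_gens4 (b : 'I_4 -> nat) : seq nat :=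
  gens4 (b ord0).+1 (b (ordS ord0)).+1 (b (ordS2 ord0)).+1 (b (ordS3 ord0)).+1.

Lemma nth_cyclic_gens4 (b : 'I_4 -> nat) (i : 'I_4) :
  nth 0 (cyclic_gens4 b) i =
  b (ordS i) * b (ordS2 i) * (b (ordS3 i)).+1 + (b (ordS i)).+1.
Proof.
have [->|->|->|->] : [\/ i = ord0, i = ordS ord0, i = ordS2 ord0 | i = ordS3 ord0].
  by case: i => [[|[|[|[|]]]] lt_i] //;
    [apply: Or41 | apply: Or42 | apply: Or43 | apply: Or44]; apply: val_inj.
all: by rewrite ?ordS4K /cyclic_gens4 /gens4 !subn1.
Qed.

Lemma cyclic_gens4_rel (b : 'I_4 -> nat) (i : 'I_4) : (forall i, 0 < b i) ->
  (\prod_i b i).-1 + nth 0 (cyclic_gens4 b) i = b (ordS i) * nth 0 (cyclic_gens4 b) (ordS i).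
Proof.
move=> b_gt0; have : 0 < \prod_i b i by apply: prodn_gt0.
by rewrite (big_ordS4 _ _ i) !nth_cyclic_gens4 ordS4K /=; lia.
Qed.

(* Telescoping the relations around the cycle gives
   [(f + 1) * n i = f * nth 0 (cyclic_gens4 b) i + n i]. *)
Lemma cyclic_rel_gens4 (n b : 'I_4 -> nat) (f : nat) (i : 'I_4) :
  0 < f -> \prod_i b i = f.+1 -> (forall j, f + n j = b (ordS j) * n (ordS j)) ->
  n i = nth 0 (cyclic_gens4 b) i.
Proof.
move=> f_gt0 prod_b rel; apply/eqP; rewrite -(eqn_pmul2l f_gt0) nth_cyclic_gens4; apply/eqP.
set n1 := n (ordS i); set b1 := b (ordS i); set b2 := b (ordS2 i).
set b3 := b (ordS3 i).
have prod_ni : f.+1 * n i = b1 * (b2 * (b3 * (f + n (ordS3 i)))).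
  by rewrite rel ordS4K -prod_b (big_ordS4 _ _ i) /=; lia.
suff : f.+1 * n i = n i + f * (b1 * b2 * b3.+1 + b1.+1) by lia.
by rewrite prod_ni mulnDr -rel addnA mulnDr -rel addnA mulnDr -rel; lia.
Qed.

Lemma gens4_almost_symmetric (a1 a2 a3 a4 : nat) (S := in_gen (gens4 a1 a2 a3 a4)) :
  2 < a1 -> 2 < a2 -> 2 < a3 -> 2 < a4 -> gcd_seq (gens4 a1 a2 a3 a4) = 1 ->
  [/\ numerical_semigroup S, embdim S 4, forall x, min_gen S x -> x \in gens4 a1 a2 a3 a4,
      almost_symmetric S & sg_type S 3].
Proof.
move=> gt1 gt2 gt3 gt4 gcd1.
pose b i := nth 0 [:: a1.-1; a2.-1; a3.-1; a4.-1] (i : 'I_4).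
have b_gt1 i : 1 < b i by case: i => [[|[|[|[|]]]] lt_i] //; rewrite /b /=; lia.
have b_gt0 i := ltnW (b_gt1 i).
have gens_b : gens4 a1 a2 a3 a4 = cyclic_gens4 b.
  by rewrite /cyclic_gens4 /b /= !prednK //; lia.
have spanS : spanned_by S (fun i : 'I_4 => nth 0 (cyclic_gens4 b) i).
  by rewrite -gens_b; apply: in_gen_spanned.
have S_cofinite : exists N, forall x, N <= x -> S x.
  have [N S_large] := in_gen_gcd_cofinite (gens4 a1 a2 a3 a4).
  by exists N => x le_x; apply: S_large => //; rewrite gcd1 dvd1n.
have prod_b : \prod_i b i = (\prod_i b i).-1.+1 by rewrite prednK // prodn_gt0.
have f_gt0 : 0 < (\prod_i b i).-1.
  by rewrite -ltnS -prod_b (big_ordS4 _ _ ord0) /= (@leq_mul 2 1) // !muln_gt0 !b_gt0.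
have rel i := cyclic_gens4_rel i b_gt0.
split.
- by split; [exact: spanned0 spanS | split; [exact: spannedD spanS | ]].
- exact: cyclic_embdim spanS S_cofinite isT f_gt0 b_gt1 rel prod_b.
- move=> x /(cyclic_min_gen spanS S_cofinite isT f_gt0 b_gt1 rel prod_b)[i ->].
  by rewrite -gens_b mem_nth.
- exact: cyclic_almost_symmetric spanS S_cofinite isT f_gt0 b_gt1 rel prod_b.
- exact: cyclic_sg_type spanS S_cofinite isT f_gt0 b_gt1 rel prod_b.
Qed.

Lemma gens4_odd (a1 a2 a3 a4 : nat) :
  odd a1 -> odd a2 -> odd a3 -> odd a4 -> all odd (gens4 a1 a2 a3 a4).
Proof.
have gen_odd a x y : odd a -> odd ((a - 1) * x * y + a).
  by case: a => // a; rewrite subn1 /= oddD !oddM /= => /negbTE->.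
by move=> odd1 odd2 odd3 odd4; rewrite /= !gen_odd.
Qed.

(** * Row factorizations *)

Section RowFactorizations.
Variables (I : finType) (n : I -> nat) (S : pred nat).
Hypothesis spanS : spanned_by S n.

Definition arrow (h : nat) (i j : I) : bool := (n j <= h + n i) && S (h + n i - n j).

Lemma arrowP h i j : reflect (exists2 v, comb n v = h + n i & 0 < v j) (arrow h i j).
Proof.
apply: (iffP andP) => [[le_j /spanS[v Ev]] | [v Ev v_gt0]].
  exists (fun x => v x + delta j x); last by rewrite /delta eqxx addn1.
  by rewrite combD comb_delta -Ev subnK.
have le_delta x : delta j x <= v x by rewrite /delta; case: eqP => // ->.
by rewrite -Ev (combB n le_delta) comb_delta leq_addr addKn; split=> //; apply: spanned_comb spanS _.
Qed.

Lemma pseudo_frob_row h i : pseudo_frob S h -> 0 < n i -> exists v, comb n v = h + n i.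
Proof.
move=> [_ pf_h] gen_gt0; have /spanS[v Ev] := pf_h _ (spanned_gen spanS i) gen_gt0.
by exists v.
Qed.

Lemma arrow_total h i : pseudo_frob S h -> 0 < n i -> exists j, arrow h i j.
Proof.
move=> pf_h gen_gt0; have [v Ev] := pseudo_frob_row pf_h gen_gt0.
have [/existsP[j v_gt0] | /existsPn v0] := boolP [exists j, 0 < v j].
  by exists j; apply/arrowP; exists v.
suff : 0 = h + n i by lia.
by rewrite -Ev -(comb0 n); apply: eq_comb => j; have := v0 j; lia.
Qed.

(* The difference of both sides of the summed equations [comb n (v t) = h t + n (i t)] has even
   nonnegative coefficients. *)
Lemma half_row_sum (T : Type) (s : seq T) (h : T -> nat) (i : T -> I) (v : T -> I -> nat) :
  all (fun t => comb n (v t) == h t + n (i t)) s ->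
  (forall x, odd (\sum_(t <- s) v t x) = odd (count (fun t => i t == x) s)) ->
  (forall x, count (fun t => i t == x) s <= \sum_(t <- s) v t x) ->
  S (\sum_(t <- s) h t)./2.
Proof.
move=> rows_s odd_s le_s; pose w x := \sum_(t <- s) v t x.
pose d x := count (fun t => i t == x) s.
have comb_w : comb n w = \sum_(t <- s) h t + comb n d.
  rewrite /w /d; elim: s rows_s {odd_s le_s w d} => [_ | t s IHs /andP[/eqP Et /IHs Es]].
    by rewrite big_nil /comb !big1 // => x _; rewrite big_nil.
  rewrite (@eq_comb _ n _ (fun x => v t x + \sum_(t <- s) v t x)) => [|x]; last by rewrite big_cons.
  rewrite [X in _ = _ + X](@eq_comb _ n _ (fun x => delta (i t) x + count (fun t => i t == x) s)).
    by rewrite !combD comb_delta Et Es big_cons addnACA.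
  by move=> x; rewrite /= /delta eq_sym.
have comb_half : comb n w = comb n (fun x => d x + (w x - d x)./2 + (w x - d x)./2).
  apply: eq_comb => x; rewrite -addnA addnn halfK oddB ?le_s // [odd (w x)]odd_s addbb subn0.
  by rewrite subnKC ?le_s.
move: comb_half; rewrite !combD comb_w addnC -addnA addnn => /addnI->.
by rewrite doubleK (spanned_comb spanS).
Qed.

Section Duality.
Variables f g : nat.
Hypotheses (frob_fg : frobenius S (f + g)) (gap_g : ~~ S g).
Hypothesis twin_fg : forall x, twin_gap S (f + g) x -> x = f \/ x = g.
Hypotheses (n_inj : injective n) (n_odd : forall i, odd (n i)) (f_odd : odd f) (g_even : ~~ odd g).

Lemma arrow_dual i j : arrow g i j = (i != j) && ~~ arrow f j i.
Proof.
have [->|ne_ij] := eqVneq i j; first by rewrite /arrow leq_addl addnK (negbTE gap_g).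
have [gap_fg large] := frob_fg; rewrite /arrow /=.
have [le_j|lt_j] := leqP (n j) (g + n i); last first.
  have le_i : n i <= f + n j by lia.
  by rewrite le_i (large (f + n j - n i)) //; lia.
have [le_i|lt_i] := leqP (n i) (f + n j); last by rewrite (large (g + n i - n j)) //; lia.
have Edual : f + g - (f + n j - n i) = g + n i - n j by lia.
apply/idP/idP => /= [S_g | gap_f].
  apply: contra gap_fg => S_f; have -> : f + g = (f + n j - n i) + (g + n i - n j) by lia.
  exact: spannedD spanS _ _ S_f S_g.
apply: contraR ne_ij => gap_g'.
have [|Ef|Eg] := twin_fg (x := f + n j - n i); first by rewrite /twin_gap Edual gap_f gap_g'.
  by apply/eqP/n_inj; lia.
by have := n_odd i; have := n_odd j; lia.
Qed.

End Duality.
End RowFactorizations.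

(** * Parity search *)

Fixpoint picks (T : Type) (Ls : seq (seq T)) : seq (seq T) :=
  if Ls is L :: Ls' then [seq x :: s | x <- L, s <- picks Ls'] else [:: [::]].

Lemma mem_picks_map (I T : eqType) (x : I -> T) (L : I -> seq T) (s : seq I) :
  ([seq x i | i <- s] \in picks [seq L i | i <- s]) = all (fun i => x i \in L i) s.
Proof.
elim: s => //= i s <-; apply/allpairsP/andP => [[[y t] [L_y Ls_t [-> ->]]] // | [L_x Ls_s]].
by exists (x i, [seq x j | j <- s]).
Qed.

Definition subvectors (r : bitseq) : seq bitseq :=
  picks [seq if b then [:: true; false] else [:: false] | b <- r].

Lemma mem_subvectors_map (I : eqType) (P Q : pred I) (s : seq I) :
  ([seq P i | i <- s] \in subvectors [seq Q i | i <- s]) = all (fun i => P i ==> Q i) s.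
Proof.
rewrite /subvectors -map_comp mem_picks_map; apply: eq_all => i /=.
by case: (P i) (Q i) => [] [].
Qed.

Fixpoint refutes (T : Type) (clash : pred (seq T)) (s : seq T) (Ls : seq (seq T)) : bool :=
  clash s || if Ls is L :: Ls' then all (fun x => refutes clash (x :: s) Ls') L else false.

Lemma refutes_sound (T : eqType) (clash : pred (seq T)) (P : T -> Prop) s (Ls : seq (seq T)) :
  (forall t, {in t, forall x, P x} -> ~~ clash t) -> {in s, forall x, P x} ->
  {in Ls, forall L, exists2 x, x \in L & P x} -> ~~ refutes clash s Ls.
Proof.
move=> no_clash; elim: Ls s => [|L Ls IHLs] s Ps PLs /=; rewrite negb_or no_clash //.
have [x L_x Px] := PLs L (mem_head _ _); apply/allPn; exists x => //; apply: IHLs.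
  by move=> y /predU1P[-> | /Ps].
by move=> L' Ls_L'; apply: PLs; rewrite inE Ls_L' orbT.
Qed.

(* Digraphs on [0, 1, 2, 3] are given by adjacency matrices [M]. The arcs of kind [true] are
   those of [M], which stand for the arrows of [f]; the arcs of kind [false] are the dual ones,
   which stand for the arrows of [g]. *)
Definition has_arc (M : seq bitseq) (k : bool) (i j : nat) : bool :=
  if k then nth false (nth [::] M i) j else (i != j) && ~~ nth false (nth [::] M j) i.

Definition digraphs : seq (seq bitseq) :=
  [seq M <- picks [seq [seq r <- subvectors [seq j != i | j <- iota 0 4] | has id r] | i <- iota 0 4]
         | all (fun i => has (has_arc M false i) (iota 0 4)) (iota 0 4)].

Definition four_cycle (M : seq bitseq) : bool :=
  has (fun p => all (fun i => all (fun j =>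
         has_arc M true (nth 0 p i) (nth 0 p j) == (j == i.+1 %% 4)) (iota 0 4)) (iota 0 4))
      (permutations (iota 0 4)).

(* The parities of the coefficients of a row factorization in which the target has a positive
   coefficient. *)
Definition row_class : Type := bool * nat * nat * bitseq.
Definition kind (x : row_class) : bool := x.1.1.1.
Definition source (x : row_class) : nat := x.1.1.2.
Definition target (x : row_class) : nat := x.1.2.
Definition parity (x : row_class) : bitseq := x.2.

(* The sum of the coefficients is even for [f + n i] and odd for [g + n i]. *)
Definition row_classes (M : seq bitseq) (a : bool * nat * nat) : seq row_class :=
  let: (k, i, j) := a in
  [seq (k, i, j, p) |
     p <- subvectors [seq has_arc M k i x | x <- iota 0 4] & odd (count id p) == ~~ k].

(* The hypotheses of [half_row_sum]: the source of one row gets an odd coefficient, which is at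
   least 1; the source of two rows gets an even one, which is at least 2 if it is also a target. *)
Definition averages (s : seq row_class) : bool :=
  all (fun x => let c := count (fun r => source r == x) s in
         (odd (count (fun r => nth false (parity r) x) s) == odd c) &&
         ((c <= 1) || (c == 2) && has (fun r => target r == x) s)) (iota 0 4).

(* Two rows of the same kind average to [f] or [g], two rows of each kind to [f + g]. *)
Definition clash (s : seq row_class) : bool :=
  if s is x :: s' then
    let same := [seq y <- s' | (kind y == kind x) && (source y != source x)] in
    let other := [seq y <- s' | kind y != kind x] in
    has (fun y => averages [:: x; y]) same ||
    has (fun y => has (fun z => has (fun t =>
           (source z < source t) && averages [:: x; y; z; t]) other) other) same
  else false.

(* Choosing first the rows with the fewest possible parities keeps the search tree small. *)
Definition excluded (M : seq bitseq) : bool :=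
  refutes clash [::] (sort (fun L L' => size L <= size L')
    [seq row_classes M a |
       a <- [seq (h.1, h.2, j) |
               h <- [seq (k, i) | k <- [:: false; true], i <- iota 0 4], j <- iota 0 4]
       & has_arc M a.1.1 a.1.2 a.2]).

Lemma digraph_classification : all (fun M => four_cycle M || excluded M) digraphs.
Proof. by lazy. Qed.

Lemma all_iotaP (e : nat) (P : pred nat) : reflect (forall i : 'I_e, P i) (all P (iota 0 e)).
Proof.
rewrite -val_enum_ord all_map; apply: (iffP allP) => P_ord i; last by move=> _; apply: P_ord.
by apply: P_ord; rewrite mem_enum.
Qed.

Lemma has_iotaP (e : nat) (P : pred nat) : reflect (exists i : 'I_e, P i) (has P (iota 0 e)).
Proof.
rewrite -val_enum_ord has_map; apply: (iffP hasP) => [[i _ P_i] | [i P_i]]; first by exists i.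
by exists i; rewrite ?mem_enum.
Qed.

Lemma odd_bigsum (T : Type) (s : seq T) (F : T -> nat) :
  odd (\sum_(x <- s) F x) = odd (count (odd \o F) s).
Proof. by elim: s => [|x s IHs]; rewrite ?big_nil // big_cons /= !oddD IHs oddb. Qed.

Section ParitySearch.
Variables (n : 'I_4 -> nat) (S : pred nat) (f g : nat).
Hypotheses (spanS : spanned_by S n) (n_inj : injective n) (n_odd : forall i, odd (n i)).
Hypotheses (frob_fg : frobenius S (f + g)) (pf_f : pseudo_frob S f) (pf_g : pseudo_frob S g).
Hypothesis twin_fg : forall x, twin_gap S (f + g) x -> x = f \/ x = g.
Hypotheses (f_odd : odd f) (g_even : ~~ odd g).

Let gap (k : bool) : nat := if k then f else g.

Definition adjacency : seq bitseq :=
  [seq [seq arrow n S f (inord i) (inord j) | j <- iota 0 4] | i <- iota 0 4].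

Definition parity_vector (v : 'I_4 -> nat) : bitseq := [seq odd (v (inord x)) | x <- iota 0 4].

Lemma nth_parity_vector v (x : 'I_4) : nth false (parity_vector v) x = odd (v x).
Proof. by rewrite (nth_map 0) ?size_iota // nth_iota // inord_val. Qed.

Lemma has_arc_adjacency k (i j : 'I_4) : has_arc adjacency k i j = arrow n S (gap k) i j.
Proof.
have entry_adjacency (x y : 'I_4) : nth false (nth [::] adjacency x) y = arrow n S f x y.
  by do 2!(rewrite (nth_map 0) ?size_iota // nth_iota // inord_val).
by case: k; rewrite /has_arc !entry_adjacency // (arrow_dual spanS frob_fg _ twin_fg) //; case: pf_g.
Qed.

Lemma gap_arrow_total k i : exists j, arrow n S (gap k) i j.
Proof. by apply: (arrow_total spanS); [case: k | apply: odd_gt0]. Qed.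

Lemma arrow_irreflexive k i : arrow n S (gap k) i i = false.
Proof. by rewrite /arrow leq_addl addnK; apply/negbTE; case: k; [case: pf_f | case: pf_g]. Qed.

Lemma adjacency_digraph : adjacency \in digraphs.
Proof.
rewrite mem_filter; apply/andP; split.
  apply/all_iotaP => i; have [j arrow_ij] := gap_arrow_total false i.
  by apply/has_iotaP; exists j; rewrite has_arc_adjacency.
rewrite mem_picks_map; apply/all_iotaP => i; rewrite mem_filter mem_subvectors_map has_map inord_val.
apply/andP; split.
  by have [j arrow_ij] := gap_arrow_total true i; apply/has_iotaP; exists j; rewrite /= inord_val.
apply/all_iotaP => j /=; rewrite inord_val; apply/implyP; apply: contraTneq => /val_inj->.
by rewrite (arrow_irreflexive true).
Qed.

Record row := Row {
  row_kind : bool; row_source : 'I_4; row_target : 'I_4; row_coef : 'I_4 -> nat }.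

Definition row_valid (r : row) : bool :=
  (comb n (row_coef r) == gap (row_kind r) + n (row_source r)) && (0 < row_coef r (row_target r)).

Definition class_of (r : row) : row_class :=
  (row_kind r, row_source r : nat, row_target r : nat, parity_vector (row_coef r)).

Definition realized (x : row_class) : Prop := exists2 r, row_valid r & class_of r = x.

Lemma averages_sound (s : seq row) :
  all row_valid s -> averages [seq class_of r | r <- s] -> S (\sum_(r <- s) gap (row_kind r))./2.
Proof.
move=> valid_s /allP avg_s.
have target_gt0 x : has (fun r => row_target r == x) s -> 0 < \sum_(r <- s) row_coef r x.
  elim: s valid_s {avg_s} => //= r s IHs /andP[/andP[_ coef_gt0] /IHs{}IHs].
  by rewrite big_cons addn_gt0 => /orP[/eqP<- | /IHs->]; rewrite ?coef_gt0 ?orbT.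
have avg_coef x (c := count (fun r => row_source r == x) s) (w := \sum_(r <- s) row_coef r x) :
    odd w = odd c /\ (c <= 1 \/ c = 2 /\ 0 < w).
  have /avg_s : (x : nat) \in iota 0 4 by rewrite mem_iota ltn_ord.
  rewrite /= !count_map has_map => /andP[/eqP odd_c c_le2]; split.
    rewrite odd_bigsum -odd_c; congr odd; apply: eq_count => r.
    exact/esym/nth_parity_vector.
  by case/orP: c_le2 => [|/andP[/eqP c2 target_x]]; [left | right; split=> //; apply: target_gt0].
apply: (half_row_sum spanS (i := row_source) (v := row_coef)).
- by apply: sub_all valid_s => r /andP[].
- by move=> x; case: (avg_coef x).
- by move=> x; have [] := avg_coef x; move: (count _ s) (\sum_(r <- s) _) => c w; lia.
Qed.

Lemma clash_sound t : {in t, forall x, realized x} -> ~~ clash t.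
Proof.
case: t => [|x t] //= real_t; have [r valid_r <-] := real_t x (mem_head _ _).
have real_tail (P : pred row_class) y : y \in [seq y <- t | P y] ->
    exists q, [/\ row_valid q, class_of q = y & P y].
  rewrite mem_filter => /andP[P_y t_y].
  by have [|q valid_q class_q] := real_t y; rewrite ?inE ?t_y ?orbT //; exists q.
have gapP k : ~~ S (gap k) by case: k; [case: pf_f | case: pf_g].
have kindE q : kind (class_of q) = row_kind q by [].
apply/negP => /orP[]/hasP[_ /real_tail[q [valid_q <- /andP[/eqP + _]]]]; rewrite !kindE => same_q.
  move=> avg_rq; have := @averages_sound [:: r; q]; rewrite /= valid_r valid_q avg_rq.
  by rewrite big_cons big_seq1 same_q addnn doubleK (negbTE (gapP _)) => /(_ isT isT).
case/hasP=> _ /real_tail[z [valid_z <- +]]; rewrite !kindE => other_z.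
case/hasP=> _ /real_tail[u [valid_u <- +]] /andP[_ avg_rqzu]; rewrite !kindE => other_u.
have := @averages_sound [:: r; q; z; u]; rewrite /= valid_r valid_q valid_z valid_u avg_rqzu.
rewrite !big_cons big_nil same_q => /(_ isT isT); apply/negP; case: frob_fg => gap_fg _.
have -> : gap (row_kind r) + (gap (row_kind r) + (gap (row_kind z) + (gap (row_kind u) + 0)))
    = (f + g).*2.
  move: other_z other_u; rewrite /gap.
  by case: (row_kind r) (row_kind z) (row_kind u) => [] [] [] //; lia.
by rewrite doubleK.
Qed.

Lemma has_arc_realized k i j :
  has_arc adjacency k (i : 'I_4) (j : 'I_4) ->
  exists2 x, x \in row_classes adjacency (k, i : nat, j : nat) & realized x.
Proof.
rewrite has_arc_adjacency => /(arrowP spanS)[v Ev v_gt0].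
exists (class_of (Row k i j v)); last by exists (Row k i j v); rewrite // /row_valid Ev eqxx.
apply: (map_f (fun p => (k, i : nat, j : nat, p))); rewrite mem_filter; apply/andP; split.
  have -> : odd (count id (parity_vector v)) = odd (comb n v).
    rewrite /comb -big_enum odd_bigsum /parity_vector -(val_enum_ord 4) -map_comp count_map.
    by congr odd; apply: eq_count => x /=; rewrite inord_val oddM n_odd andbT.
  by rewrite Ev oddD n_odd addbT; case: k {Ev} => /=; rewrite ?f_odd ?(negbTE g_even).
rewrite mem_subvectors_map; apply/all_iotaP => x; apply/implyP; rewrite inord_val => odd_v.
by rewrite has_arc_adjacency; apply/(arrowP spanS); exists v; rewrite // odd_gt0.
Qed.

Lemma adjacency_four_cycle : four_cycle adjacency.
Proof.
have /orP[] := allP digraph_classification _ adjacency_digraph; first exact.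
apply: contraTT => _; apply: refutes_sound clash_sound _ _ => // L.
rewrite mem_sort => /mapP[a]; rewrite mem_filter.
case/andP=> arc_a /allpairsP[[h j] [/allpairsP[[k i] [_ idx_i h_eq]] idx_j a_eq]] ->.
move: arc_a idx_i idx_j; rewrite a_eq h_eq !mem_iota /= => arc_a lt_i lt_j; move: arc_a.
exact: (@has_arc_realized k (Ordinal lt_i) (Ordinal lt_j)).
Qed.

Lemma arrow_four_cycle : exists2 s : 'I_4 -> 'I_4,
  bijective s & forall i j, arrow n S f (s i) (s j) = (j == ordS i).
Proof.
have /hasP[p] := adjacency_four_cycle; rewrite mem_permutations => perm_p /all_iotaP cyc_p.
have size_p : size p = 4 by rewrite (perm_size perm_p).
have lt_p (i : 'I_4) : nth 0 p i < 4.
  have : nth 0 p i \in p by rewrite mem_nth ?size_p.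
  by rewrite (perm_mem perm_p) mem_iota.
exists (fun i => Ordinal (lt_p i)).
  apply: injF_bij => i j /(congr1 val)/eqP /=.
  by rewrite nth_uniq ?size_p ?(perm_uniq perm_p) // => /eqP/val_inj.
move=> i j; rewrite -(has_arc_adjacency true) /=.
by have /all_iotaP/(_ j)/eqP := cyc_p i.
Qed.

End ParitySearch.

(** * The four-cycle *)

Lemma row_coef_eq0 (n : 'I_4 -> nat) (S : pred nat) (h : nat) (i : 'I_4) (c0 c1 c2 c3 : nat) :
  spanned_by S n -> h + n i = c0 * n i + c1 * n (ordS i) + c2 * n (ordS2 i) + c3 * n (ordS3 i) ->
  [/\ ~~ arrow n S h i i -> c0 = 0, ~~ arrow n S h i (ordS i) -> c1 = 0,
      ~~ arrow n S h i (ordS2 i) -> c2 = 0 & ~~ arrow n S h i (ordS3 i) -> c3 = 0].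
Proof.
move=> spanS row_i; have [v [v0 v1 v2 v3]] : exists v : 'I_4 -> nat,
    [/\ v i = c0, v (ordS i) = c1, v (ordS2 i) = c2 & v (ordS3 i) = c3].
  exists (fun x => nth 0 [:: c0; c1; c2; c3] (index x [:: i; ordS i; ordS2 i; ordS3 i])).
  by case: i {row_i} => [[|[|[|[|]]]]].
have v_eq0 j : ~~ arrow n S h i j -> v j = 0.
  move/(arrowP spanS) => no_arrow; have [//|v_gt0] := posnP (v j); case: no_arrow; exists v => //.
  by rewrite /comb (big_ordS4 _ _ i) /= !addnA v0 v1 v2 v3.
by rewrite -v0 -v1 -v2 -v3; split; apply: v_eq0.
Qed.

Section FourCycle.
Variables (n : 'I_4 -> nat) (S : pred nat) (f g : nat).
Hypotheses (spanS : spanned_by S n) (n_inj : injective n) (n_odd : forall i, odd (n i)).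
Hypotheses (frob_fg : frobenius S (f + g)) (pf_f : pseudo_frob S f) (pf_g : pseudo_frob S g).
Hypothesis twin_fg : forall x, twin_gap S (f + g) x -> x = f \/ x = g.
Hypotheses (f_odd : odd f) (g_even : ~~ odd g).
Hypothesis arrow_cycle : forall i j, arrow n S f i j = (j == ordS i).

Lemma coarrow_cycle i j : arrow n S g i j = (i != j) && (i != ordS j).
Proof.
by rewrite (arrow_dual spanS frob_fg _ twin_fg) //; [rewrite arrow_cycle | case: pf_g].
Qed.

Lemma f_row_support i c0 c1 c2 c3 :
  f + n i = c0 * n i + c1 * n (ordS i) + c2 * n (ordS2 i) + c3 * n (ordS3 i) ->
  [/\ c0 = 0, c2 = 0 & c3 = 0].
Proof.
have [ne0 ne2 ne3] : [/\ i != ordS i, ordS2 i != ordS i & ordS3 i != ordS i].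
  by case: i => [[|[|[|[|]]]]].
case/(row_coef_eq0 spanS); rewrite !arrow_cycle => zero0 _ zero2 zero3.
by split; [apply: zero0 | apply: zero2 | apply: zero3].
Qed.

Lemma g_row_support i c0 c1 c2 c3 :
  g + n i = c0 * n i + c1 * n (ordS i) + c2 * n (ordS2 i) + c3 * n (ordS3 i) ->
  c0 = 0 /\ c3 = 0.
Proof.
case/(row_coef_eq0 spanS); rewrite !coarrow_cycle ordS4K !eqxx andbF => zero0 _ _ zero3.
by split; [apply: zero0 | apply: zero3].
Qed.

Lemma f_row i : exists b, [/\ f + n i = b * n (ordS i), ~~ odd b & 1 < b].
Proof.
have gen_gt0 := odd_gt0 (n_odd i); have [v] := pseudo_frob_row spanS pf_f gen_gt0.
rewrite /comb (big_ordS4 _ _ i) /= !addnA => /esym row_i.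
have [v0 v2 v3] := f_row_support row_i; rewrite v0 v2 v3 !mul0n !addn0 in row_i.
have even_v : ~~ odd (v (ordS i)).
  by have := congr1 odd row_i; rewrite oddD oddM f_odd !n_odd andbT => <-.
by exists (v (ordS i)); split=> //; move: row_i even_v; case: (v _) => [|[|k]] //=; lia.
Qed.

Lemma g_row i : exists x y, g + n i = x * n (ordS i) + y * n (ordS2 i).
Proof.
have [v] := pseudo_frob_row spanS pf_g (odd_gt0 (n_odd i)).
rewrite /comb (big_ordS4 _ _ i) /= !addnA => /esym row_i.
have [v0 v3] := g_row_support row_i; rewrite v0 v3 !mul0n addn0 in row_i.
by exists (v (ordS i)), (v (ordS2 i)).
Qed.

Section Relations.
Variable b : 'I_4 -> nat.
Hypothesis cyclic_rel : forall i, f + n i = b (ordS i) * n (ordS i).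

Lemma muln_gen_support i k c0 c2 c3 :
  k <= b (ordS i) -> k * n (ordS i) = c0 * n i + c2 * n (ordS2 i) + c3 * n (ordS3 i) ->
  [/\ c0 = 0, c2 = 0 & c3 = 0].
Proof.
move=> le_kb Ek; apply: (@f_row_support i c0 (b (ordS i) - k) c2 c3).
by rewrite cyclic_rel -{1}(subnK le_kb) mulnDl Ek; lia.
Qed.

(* Subtracting the two rows and the relations for [i] and [ordS2 i] leaves the relation [exchange],
   which must be trivial by the supports of the rows. *)
Lemma g_row_coef i x1 x2 y2 y3 :
  g + n i = x1 * n (ordS i) + x2 * n (ordS2 i) ->
  g + n (ordS i) = y2 * n (ordS2 i) + y3 * n (ordS3 i) ->
  x1.+1 = b (ordS i) /\ x2 = y2.+1.
Proof.
have rel0 := cyclic_rel i; have rel2 := cyclic_rel (ordS2 i); have n1_gt0 := odd_gt0 (n_odd (ordS i)).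
have support1 := @muln_gen_support i; have support_g := @g_row_support i.
have not_above k1 k2 : g <> f + (k1 * n (ordS i) + k2 * n (ordS2 i)).
  apply: (pseudo_frob_incomparable pf_f pf_g); last by apply: contraNneq g_even => <-.
  by rewrite !(spannedD spanS, spannedM spanS, spanned_gen spanS).
move: (n i) (n (ordS i)) (n (ordS2 i)) (n (ordS3 i)) (b (ordS i)) (b (ordS3 i))
  => n0 n1 n2 n3 b1 b3 in rel0 rel2 n1_gt0 support1 support_g not_above *.
move=> row0 row1.
have lt_x1 : x1 < b1.
  rewrite ltnNge; apply/negP => /subnKC x1_ge.
  by apply: (not_above (x1 - b1) x2); move: row0; rewrite -x1_ge; lia.
have lt_y2 : y2 < x2.
  rewrite ltnNge; apply/negP => /subnKC y2_ge.
  by have [] // := support1 x1.+1 1 (y2 - x2) y3 lt_x1; move: row1; rewrite -y2_ge; lia.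
have exchange : b3 * n3 + (x2 - y2.+1) * n2 = y3 * n3 + (b1 - x1.+1) * n1.
  by move: row0 row1 rel0; rewrite -{1}(subnKC lt_y2) -{1}(subnKC lt_x1); lia.
have le_y3 : y3 <= b3.
  rewrite leqNgt; apply/negP => /subnKC y3_gt; rewrite -y3_gt in exchange.
  have [] // := support_g 0 (x1 + (b1 - x1.+1)) y2.+1 (y3 - b3.+1).+1.
  by move: row0; rewrite -{1}(subnKC lt_y2); lia.
have [||_ x2_le y3_ge] := support1 (b1 - x1.+1) 0 (x2 - y2.+1) (b3 - y3); first exact: leq_subr.
  by move: exchange; rewrite -{1}(subnKC le_y3); lia.
have y3_b3 : y3 = b3 by lia.
by move: exchange; rewrite x2_le y3_b3 => /addnI/esym/eqP; rewrite muln_eq0; lia.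
Qed.

Lemma g_double : g = f + f.
Proof.
have [x1 [x2 row0]] := g_row ord0; have [y2 [y3 row1]] := g_row (ordS ord0).
have [z3 [z0 row2]] := g_row (ordS2 ord0).
have [x1_b x2_y2] := g_row_coef row0 row1; have [y2_b _] := g_row_coef row1 row2.
have := cyclic_rel ord0; have := cyclic_rel (ordS ord0).
by move: row0; rewrite x2_y2 y2_b -x1_b; lia.
Qed.

Lemma four_cycle_mulf_gap k : 0 < k < 4 -> ~~ S (k * f).
Proof.
case: k => [|[|[|[|]]]] // _; first by rewrite mul1n; case: pf_f.
  by rewrite mul2n -addnn -g_double; case: pf_g.
have -> : 3 * f = f + g by rewrite g_double; lia.
by case: frob_fg.
Qed.

End Relations.

Lemma four_cycle_gens4 : exists a1 a2 a3 a4 : nat,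
  [/\ odd a1, odd a2, odd a3 & odd a4] /\ [/\ 1 < a1, 1 < a2, 1 < a3 & 1 < a4] /\
  forall x, S x = in_gen (gens4 a1 a2 a3 a4) x.
Proof.
have [b bP] := fin_all_exists (fun i => f_row (ord_pred i)).
have cyclic_rel i : f + n i = b (ordS i) * n (ordS i) by have [] := bP (ordS i); rewrite ordSK.
have succ_b_odd i : odd (b i).+1 by have [_ even_b _] := bP i.
have b_gt1 i : 1 < b i by have [] := bP i.
have S_cofinite : exists N, forall x, N <= x -> S x.
  by exists (f + g).+1 => x; apply: (proj2 frob_fg).
have f_gt0 : 0 < f by apply: odd_gt0.
have prod_b := cyclic_gaps_prod spanS S_cofinite isT f_gt0 b_gt1 cyclic_rel
  (four_cycle_mulf_gap cyclic_rel).
exists (b ord0).+1, (b (ordS ord0)).+1, (b (ordS2 ord0)).+1, (b (ordS3 ord0)).+1.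
split; first by split; apply: succ_b_odd.
split; first by split; apply: ltnW (b_gt1 _).
apply: (eq_spanned_by spanS (in_gen_spanned (cyclic_gens4 b))) => i.
exact: cyclic_rel_gens4 f_gt0 prod_b cyclic_rel.
Qed.

End FourCycle.

Theorem theorem5p7 :
  (forall a1 a2 a3 a4 : nat,
      odd a1 -> odd a2 -> odd a3 -> odd a4 ->
      1 < a1 -> 1 < a2 -> 1 < a3 -> 1 < a4 ->
      gcd_seq (gens4 a1 a2 a3 a4) = 1 ->
      let S := in_gen (gens4 a1 a2 a3 a4) in
      numerical_semigroup S /\ embdim S 4 /\
      all odd (gens4 a1 a2 a3 a4) /\ (forall x, min_gen S x -> odd x) /\
      almost_symmetric S /\ sg_type S 3)
  /\
  (forall S : pred nat,
      numerical_semigroup S -> embdim S 4 -> almost_symmetric S ->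
      sg_type S 3 -> (forall x, min_gen S x -> odd x) ->
      exists a1 a2 a3 a4 : nat,
        [/\ odd a1, odd a2, odd a3 & odd a4] /\
        [/\ 1 < a1, 1 < a2, 1 < a3 & 1 < a4] /\
        forall x, S x = in_gen (gens4 a1 a2 a3 a4) x).
Proof.
split=> [a1 a2 a3 a4 odd1 odd2 odd3 odd4 gt1 gt2 gt3 gt4 gcd1 S | S numS embS asymS type3 odd_gens].
  have [||||numS embS gensS asymS typeS] := gens4_almost_symmetric _ _ _ _ gcd1; try by lia.
  have gens_odd := gens4_odd odd1 odd2 odd3 odd4.
  by do 3!split=> //; split=> [x /gensS/(allP gens_odd)|].
have [n [n_inj spanS min_n]] := embdim_gens numS embS.
have n_odd i : odd (n i) by apply/odd_gens/min_n.
have [f [g [[f_odd g_even pf_f pf_g] [frob_fg twin_fg]]]] := almost_symmetric_type3 numS asymS type3.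
have [s s_bij arrow_s] :=
  arrow_four_cycle spanS n_inj n_odd frob_fg pf_f pf_g twin_fg f_odd g_even.
have ns_inj := inj_comp n_inj (bij_inj s_bij); have ns_odd i := n_odd (s i).
exact: (four_cycle_gens4 (spanned_by_bij spanS s_bij) ns_inj ns_odd frob_fg pf_f pf_g twin_fg).
Qed.
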